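(* Let $n\geq 2$ and let $\sigma\in\mathfrak{S}_n$ be an irreducible permutation, with cycle invariant $(\lambda,r)$, where $\lambda=\{\lambda_1,\dots,\lambda_\ell\}$ is the multiset of cycle lengths and $r$ the rank, and $\ell=|\lambda|$ is the number of cycles (not counting the rank path). Then: (1) the list $\lambda\cup\{r\}=\{\lambda_1,\dots,\lambda_\ell,r\}$ contains an even number of even entries; (2) $\bar A(\sigma)=\pm 2^{\frac{n+\ell}{2}}$ if the list $\lambda\cup\{r\}$ has no even entries, and $\bar A(\sigma)=0$ otherwise.
   Context: A permutation $\sigma\in\mathfrak{S}_n$ is irreducible if $\{\sigma(1),\dots,\sigma(k)\}\neq\{n-k+1,\dots,n\}$ for every $1\le k<n$. Represent $\sigma$ as a diagram in a horizontal strip with points $1,\dots,n$ (left to right) on the bottom and top boundaries, and edges $(i^-,\sigma(i)^+)$. Cycle invariant: (1) replace each endpoint $i^{\pm}$ by a black and a white point $i_b^{\pm}, i_w^{\pm}$ (black to the left), and replace each edge $(i^-,j^+)$, $j=\sigma(i)$, by the two crossing edges $(i_b^-,j_w^+)$ and $(i_w^-,j_b^+)$; (2) for $i=1,\dots,n-1$ join by an arc $i_w^-$ to $(i+1)_b^-$ (bottom arcs) and $i_w^+$ to $(i+1)_b^+$ (top arcs); (3) join $n_w^+$ to $1_b^-$ by an extra arc (the ''$-1$ mark''). The resulting graph is a disjoint union of closed cycles and one open path (the rank path) from $1_b^+$ to $n_w^-$. The length of a cycle or of the rank path is the number of top arcs (equivalently, bottom arcs) of step (2) it contains; the $-1$ mark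 is not counted. The rank $r$ is the length of the rank path, and $\lambda$ is the multiset of lengths of the closed cycles. Arf invariant: identify the edges of $\sigma$ with $[n]$; for $I\subseteq[n]$ let $\chi(I)$ be the number of pairs $\{i,j\}\subseteq I$, $i<j$, of non-crossing edges, i.e. with $\sigma(i)<\sigma(j)$. Then $\bar A(\sigma)=\sum_{I\subseteq[n]}(-1)^{|I|+\chi(I)}$. *)

(* Defs.v *)
From mathcomp Require Import all_boot all_order all_fingroup all_algebra.

Set Implicit Arguments.
Unset Strict Implicit.
Unset Printing Implicit Defensive.

Import GRing.Theory.

(* Indices run over 'I_n = {0, ..., n-1}, i.e. they are shifted down by one:
   {sigma(1), ..., sigma(k)} is the image of {i | i < k}, and {n-k+1, ..., n}
   is {j | n - k <= j}. *)
Definition irreducible_perm (n : nat) (sigma : 'S_n) : Prop :=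
  forall k : nat, (1 <= k < n)%N ->
    sigma @: [set i : 'I_n | (i < k)%N] <> [set j : 'I_n | (n - k <= j)%N].

(* The 4n points i_b^-, i_w^-, i_b^+, i_w^+: the first boolean is true for the
   top boundary (+), the second is true for white. *)
Definition point (n : nat) : finType := (bool * bool * 'I_n)%type.

Definition is_top (n : nat) (x : point n) : bool := x.1.1.
Definition is_white (n : nat) (x : point n) : bool := x.1.2.
Definition pos (n : nat) (x : point n) : 'I_n := x.2.

(* (i_b^-, sigma(i)_w^+) and (i_w^-, sigma(i)_b^+) *)
Definition crossing_edge (n : nat) (sigma : 'S_n) (x y : point n) : bool :=
  [&& ~~ is_top x, is_top y, pos y == sigma (pos x)
    & is_white x != is_white y].

(* (i_w^+, (i+1)_b^+) *)
Definition top_arc (n : nat) (x y : point n) : bool :=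
  [&& is_top x, is_top y, is_white x, ~~ is_white y
    & pos y == (pos x).+1 :> nat].

(* (i_w^-, (i+1)_b^-) *)
Definition bottom_arc (n : nat) (x y : point n) : bool :=
  [&& ~~ is_top x, ~~ is_top y, is_white x, ~~ is_white y
    & pos y == (pos x).+1 :> nat].

(* (n_w^+, 1_b^-) *)
Definition minus_one_mark (n : nat) (x y : point n) : bool :=
  [&& is_top x, is_white x, (pos x).+1 == n,
      ~~ is_top y, ~~ is_white y & pos y == 0 :> nat].

Definition edge (n : nat) (sigma : 'S_n) (x y : point n) : bool :=
  [|| crossing_edge sigma x y, top_arc x y, bottom_arc x y
    | minus_one_mark x y].

Definition adjacent (n : nat) (sigma : 'S_n) : rel (point n) :=
  [rel x y | edge sigma x y || edge sigma y x].

Definition components (n : nat) (sigma : 'S_n) : {set {set point n}} :=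
  equivalence_partition (connect (adjacent sigma)) [set: point n].

(* 1_b^+ *)
Definition rank_path_start (n : nat) (x : point n) : bool :=
  [&& is_top x, ~~ is_white x & pos x == 0 :> nat].

Definition rank_path (n : nat) (sigma : 'S_n) : {set point n} :=
  [set y | [exists x, rank_path_start x && connect (adjacent sigma) x y]].

(* Every point lies on exactly one crossing edge, and every point except 1_b^+
   and n_w^- lies on exactly one arc or on the mark; so the components other
   than the rank path are exactly the closed cycles. *)
Definition cycles (n : nat) (sigma : 'S_n) : {set {set point n}} :=
  components sigma :\ rank_path sigma.

Definition path_length (n : nat) (C : {set point n}) : nat :=
  #|[set e : point n * point n |
      [&& e.1 \in C, e.2 \in C & top_arc e.1 e.2]]|.

Definition rank (n : nat) (sigma : 'S_n) : nat := path_length (rank_path sigma).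

(* A multiset, represented by a list whose order is immaterial. *)
Definition cycle_type (n : nat) (sigma : 'S_n) : seq nat :=
  [seq path_length C | C <- enum (cycles sigma)].

(* The list lambda \cup {r}. *)
Definition cycle_invariant_list (n : nat) (sigma : 'S_n) : seq nat :=
  rcons (cycle_type sigma) (rank sigma).

Definition chi (n : nat) (sigma : 'S_n) (I : {set 'I_n}) : nat :=
  #|[set p : 'I_n * 'I_n |
      [&& p.1 \in I, p.2 \in I, (p.1 < p.2)%N & (sigma p.1 < sigma p.2)%N]]|.

Definition arf (n : nat) (sigma : 'S_n) : int :=
  (\sum_(I : {set 'I_n}) (-1) ^+ (#|I| + chi sigma I))%R.

(* Main.v *)
Require Import Defs.
From mathcomp Require Import all_boot all_order all_fingroup all_algebra.

(* [arf sigma] is the Gauss sum of a quadratic form q over F_2 whose polar form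
   is b(i, j) = [edges i and j do not cross].  Such a sum vanishes as soon as q
   is nonzero somewhere on the radical of b, and otherwise its square is 2^n
   times the size of the radical.

   The radical is the space of differences x_i = F(i) + F(i+1), where F is a
   function on the n+1 gaps of the bottom boundary that is constant along the
   cycles and the (closed up) rank path, i.e. invariant under the permutation
   [gap_perm] of the gaps; x determines F up to a constant, so the radical has
   2^l elements.

   When F is the indicator of one cycle with L gaps, q(x) is evaluated by
   counting mod 2 the inversions of the two maps composing [gap_perm]: their
   composite is a cycle of length L on these gaps, so it has L - 1 inversions
   mod 2.  This yields q(x) = 1 + length of the cycle.  Since q is additive on
   the radical and the indicators of all the cycles add up to a constant F, i.e.
   to x = 0, the number of even lengths is even. *)

Set Implicit Arguments.
Unset Strict Implicit.
Unset Printing Implicit Defensive.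

Import GRing.Theory Num.Theory.
Local Open Scope ring_scope.

(** * Gauss sums of quadratic forms over F_2 *)

Section GaussSum.

Variables (V : finZmodType) (q : V -> bool) (b : V -> V -> bool).
Hypothesis qD : forall x y, q (x + y) = q x + q y + b x y.
Hypothesis bDl : forall x y z, b (x + y) z = b x z + b y z.

Let gauss_sum : int := \sum_x (-1) ^+ q x.
Let radical := [set z | [forall y, ~~ b y z]].

Lemma signr_addr (c d : bool) : (-1) ^+ (c + d)%R = (-1) ^+ c * (-1) ^+ d :> int.
Proof. exact: signr_addb. Qed.

Lemma int_eq_opp0 (a : int) : a = - a -> a = 0.
Proof.
by move=> aN; apply/eqP; rewrite -eqNr -aN.
Qed.

(** Translation by [z] is a bijection of [V] that flips the sign of every term, so the sum equals
    its own opposite. *)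
Lemma gauss_sum_eq0 z : z \in radical -> q z -> gauss_sum = 0.
Proof.
rewrite inE => /forallP rz qz; apply: int_eq_opp0.
rewrite {1}/gauss_sum (reindex_inj (addIr z)) -sumrN.
apply: eq_bigr => x _.
by rewrite qD qz (negPf (rz x)) addr0 signr_addr mulrN1.
Qed.

(** Orthogonality of characters: the sign of [b x z] is a character in [x], trivial exactly for [z]
    in the radical. *)
Lemma sum_sign_bilinear z :
  \sum_x (-1) ^+ b x z = (if z \in radical then #|V|%:R else 0) :> int.
Proof.
rewrite inE; case: ifP => [/forallP rz | /negbT/forallPn[y]].
  rewrite (eq_bigr (fun=> 1)) ?sumr_const // => x _.
  by rewrite (negPf (rz x)).
rewrite negbK => byz; apply: int_eq_opp0.
rewrite {1}(reindex_inj (addIr y)) -sumrN; apply: eq_bigr => x _.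
by rewrite bDl byz signr_addr mulrN1.
Qed.

Lemma gauss_sum_sqr :
  (forall z, z \in radical -> ~~ q z) ->
  gauss_sum ^+ 2 = (#|V| * #|radical|)%:R.
Proof.
move=> q0; rewrite expr2 big_distrlr /=.
(* Write the second variable of the double sum as [x + z]: then [q x + q (x + z) = q z + b x z], and
   summing over [x] first keeps only the [z] in the radical. *)
transitivity (\sum_z (-1) ^+ q z * \sum_x (-1) ^+ b x z : int).
  under [RHS]eq_bigr do rewrite mulr_sumr.
  rewrite [RHS]exchange_big; apply: eq_bigr => x _ /=.
  rewrite (reindex_inj (addrI x)); apply: eq_bigr => z _.
  by rewrite -!signr_addr qD; case: (q x); case: (q z); case: (b x z).
under eq_bigr do rewrite sum_sign_bilinear.
rewrite (bigID (mem radical)) /= addrC big1 ?add0r => [|z /negPf->]; last by rewrite mulr0.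
rewrite (eq_bigr (fun=> #|V|%:R)) => [|z rz]; last first.
  by rewrite rz (negPf (q0 z rz)) mul1r.
by rewrite sumr_const natrM mulr_natr.
Qed.

End GaussSum.

(** * Symmetric sums and inversions modulo 2 *)

Section SymmetricSums.

Lemma natr_bool k : k%:R = odd k :> bool.
Proof. by elim: k => // k IHk; rewrite -natr1 IHk /=; case: (odd k). Qed.

Lemma addbool_self (c : bool) : c + c = 0.
Proof. by case: c. Qed.

Variable T : finType.

Lemma sum_symmetric_eq0 (d : T -> T -> bool) :
    (forall x, d x x = 0) -> (forall x y, d x y = d y x) ->
  \sum_x \sum_y d x y = 0.
Proof.
move=> d0 dC; pose lt (x y : T) : bool := (enum_rank x < enum_rank y)%N.
have split_d x y : d x y = lt x y * d x y + lt y x * d x y.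
  rewrite /lt; case: ltngtP => [_|_|/val_inj/enum_rank_inj->].
  - by rewrite mul1r mul0r addr0.
  - by rewrite mul1r mul0r add0r.
  - by rewrite d0 !mulr0.
under eq_bigr do under eq_bigr do rewrite split_d.
under eq_bigr do rewrite big_split /=.
rewrite big_split /= [X in _ + X]exchange_big /=.
under [X in _ + X]eq_bigr do under eq_bigr do rewrite dC.
exact: addbool_self.
Qed.

(* Over F_2 a sum over unordered pairs does not depend on how each pair is
   ordered. *)
Lemma sum_pairs_reorder (u v h : T -> T -> bool) :
    (forall x, u x x = v x x) -> (forall x y, h x y = h y x) ->
    (forall x y, x != y -> h x y -> u x y + u y x = v x y + v y x) ->
  \sum_x \sum_y u x y * h x y = \sum_x \sum_y v x y * h x y.
Proof.
move=> uv hC uvC; apply/eqP; rewrite -subr_eq0 -sumrB.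
under eq_bigr do rewrite -sumrB; apply/eqP.
apply: sum_symmetric_eq0 => [x | x y]; first by rewrite uv subrr.
case: (eqVneq x y) => [-> // | xy]; rewrite (hC y x).
move: (uvC x y xy); case: (h x y) => [/(_ isT)|_]; last by rewrite !mulr0.
by case: (u x y); case: (u y x); case: (v x y); case: (v y x).
Qed.

End SymmetricSums.

(** The two copies of [g] cancel on the pairs with [1 <= i < j <= L]. What is left is [g 0 j] and
    [g j L.+1 = g j 0] for [1 <= j <= L], and each such couple adds up to 1. *)
Lemma sum_cyclic_shift (g : nat -> nat -> bool) L :
    (forall j, j < L -> g j.+1 0%N = ~~ g 0%N j.+1)%N ->
    (forall j, g j L.+1 = g j 0%N) ->
  \sum_(i < L.+1) \sum_(j < L.+1) (i < j)%N * (g i j + g i.+1 j.+1) = odd L.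
Proof.
move=> g0 gL.
under eq_bigr do under eq_bigr do rewrite mulrDr.
under eq_bigr do rewrite big_split /=.
rewrite big_split /= big_ord_recl /= big_ord_recl /= mul0r add0r.
under [X in _ + X + _]eq_bigr do rewrite big_ord_recl /= mul0r add0r.
rewrite [X in _ + X]big_ord_recr /=.
rewrite [X in _ + (_ + X)]big1 => [|j _]; last first.
  by rewrite ltnNge -ltnS ltn_ord mul0r.
rewrite addr0.
under [X in _ + X]eq_bigr do rewrite big_ord_recr /= ltn_ord mul1r gL.
rewrite [X in _ + X]big_split /= -!addrA [X in _ + X]addrA.
under [X in _ + (X + _ + _)]eq_bigr do under eq_bigr do rewrite /bump /= !add1n ltnS.
rewrite addbool_self add0r -big_split /=.
rewrite (eq_bigr (fun=> 1)) => [|j _].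
  by rewrite sumr_const card_ord natr_bool.
by rewrite /bump /= add1n g0 // mul1r; case: (g _ _).
Qed.

(* Along an orbit ordered by the iteration index, a permutation shifts the
   order cyclically and hence reverses exactly [L - 1] pairs, [L] being the
   length of the orbit. *)
Lemma sum_porbit_inversions (T : finType) (s : {perm T}) (x : T)
    (u : T -> T -> bool) (O := porbit s x)
    (before := fun y z =>
       (index y (traject s x #|O|) < index z (traject s x #|O|))%N) :
    (forall y z, y != z -> u z y = ~~ u y z) ->
  \sum_y \sum_z before y z * ((y \in O) * (z \in O) * (u y z + u (s y) (s z)))
    = ~~ odd #|O|.
Proof.
move=> uC; set tr := traject s x #|O|.
have sum_tr (f : T -> bool) :
    \sum_y (y \in O) * f y = \sum_(i < #|O|) f (iter i s x).
  transitivity (\sum_(y in O) f y).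
    by rewrite [RHS]big_mkcond; apply: eq_bigr => y _; case: (y \in O).
  rewrite (eq_bigl (mem tr)) => [|y]; last exact: porbit_traject.
  rewrite -big_uniq ?uniq_traject_porbit // (big_nth x) size_traject big_mkord.
  by apply: eq_bigr => i _; rewrite nth_traject.
have beforeE (i j : 'I_#|O|) : before (iter i s x) (iter j s x) = (i < j)%N.
  rewrite /before -/tr -!(nth_traject s (ltn_ord _) x) -/tr.
  by rewrite !index_uniq ?size_traject ?uniq_traject_porbit.
transitivity (\sum_y (y \in O) * \sum_z (z \in O) *
    (before y z * (u y z + u (s y) (s z)))).
  apply: eq_bigr => y _; rewrite mulr_sumr; apply: eq_bigr => z _.
  by rewrite -!mulrA mulrCA; congr (_ * _); rewrite mulrCA.
rewrite sum_tr; under eq_bigr do rewrite sum_tr.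
under eq_bigr do under eq_bigr do rewrite beforeE -!iterS.
have := iter_porbit s x; have := uniq_traject_porbit s x.
rewrite -/O; case: #|O| (card_porbit_neq0 s x) => // L _ Utr itL.
rewrite /= negbK -(@sum_cyclic_shift (fun i j => u (iter i s x) (iter j s x))) //.
  move=> j ltjL; apply: uC; rewrite eq_sym.
  have := @nth_uniq _ x (traject s x L.+1) j.+1 0.
  by rewrite size_traject !nth_traject // => -> .
by move=> j; rewrite itL.
Qed.

(* [F] is the indicator of an orbit of [phi * psi]; the two sums count the
   pairs of this orbit that [phi], respectively [psi], reverses. *)
Lemma sum_inversions_porbit_mul m (phi psi : 'S_m) (x : 'I_m)
    (F := fun k => k \in porbit (phi * psi)%g x) (G := fun l => F (psi l)) :
  \sum_(k < m) \sum_(k' < m) (k < k')%N * (F k * F k' * (1 + (phi k < phi k')%N)) +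
  \sum_(l < m) \sum_(l' < m) (l < l')%N * (G l * G l' * (1 + (psi l < psi l')%N))
    = 1 + \sum_(k < m) F k.
Proof.
set pi := (phi * psi)%g; pose tr := traject pi x #|porbit pi x|.
pose w (y z : 'I_m) : bool := (index y tr < index z tr)%N.
have Fpi k : F (pi k) = F k.
  by rewrite /F -!eq_porbit_mem -[pi k]/((pi ^+ 1)%g k) porbit_perm.
have ltC (y z : 'I_m) : y != z -> (z < y)%N = ~~ (y < z)%N.
  by rewrite -val_eqE -leqNgt /=; case: ltngtP.
have wC y z : y != z -> F y -> F z -> w z y = ~~ w y z.
  move=> yz; rewrite /F !porbit_traject -/tr => yt zt.
  rewrite /w; case: ltngtP => // yzE; case/eqP: yz.
  by rewrite -(nth_index x yt) -(nth_index x zt) yzE.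
have reorder (s t : 'I_m -> 'I_m) : injective s -> injective t ->
  \sum_(k < m) \sum_(k' < m) (s k < s k')%N * (F k * F k' * (1 + (t k < t k')%N)) =
  \sum_(k < m) \sum_(k' < m) w k k' * (F k * F k' * ((s k < s k')%N + (t k < t k')%N)).
  (* Wherever [s k < s k'] holds, the constant 1 may be replaced by this comparison. The factor
     becomes symmetric in [k] and [k'], so the order given by [s] can be traded for the traversal
     order [w]. *)
  move=> inj_s inj_t; transitivity (\sum_(k < m) \sum_(k' < m) (s k < s k')%N *
      (F k * F k' * ((s k < s k')%N + (t k < t k')%N))).
    apply: eq_bigr => k _; apply: eq_bigr => k' _.
    by case: (s k < s k')%N; rewrite ?mul0r.
  apply: sum_pairs_reorder => [k|k k'|k k' kk'].
  - by rewrite /w !ltnn.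
  - case: (eqVneq k k') => [-> // | kk']; rewrite [F k' * _]mulrC; congr (_ * _).
    rewrite [(s k' < _)%N]ltC ?(inj_eq inj_s) //.
    rewrite [(t k' < _)%N]ltC ?(inj_eq inj_t) //.
    by case: (s k < s k')%N; case: (t k < t k')%N.
  - case Fk: (F k); case Fk': (F k') => // _.
    rewrite [(s k' < _)%N]ltC ?(inj_eq inj_s) // (wC k k') //.
    by case: (_ < _)%N; case: (w k k').
rewrite [X in _ + X](reindex_inj (@perm_inj _ phi)) /=.
under [X in _ + X]eq_bigr do rewrite (reindex_inj (@perm_inj _ phi)) /=.
have GphiE k : G (phi k) = F k by rewrite /G -permM Fpi.
under [X in _ + X]eq_bigr do under eq_bigr do rewrite !GphiE -!permM.
(* In the order [w], both sums contain the comparison of images under [phi]. It cancels modulo 2 and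
   leaves the identity against [pi], as in [sum_porbit_inversions]. *)
rewrite (reorder (fun k => k) phi) ?(reorder phi pi) //; try exact: perm_inj.
rewrite -big_split /=.
under eq_bigr do rewrite -big_split /=.
transitivity (~~ odd #|porbit pi x|).
  rewrite -(@sum_porbit_inversions _ pi x (fun y z : 'I_m => (y < z)%N)) //.
  apply: eq_bigr => y _; apply: eq_bigr => z _.
  rewrite -mulrDr -mulrDr; congr (_ * (_ * _)).
  by rewrite -/pi; do 3!case: (_ < _)%N.
transitivity (1 + \sum_(k in porbit pi x) 1 : bool).
  by rewrite sumr_const natr_bool; case: (odd _).
congr (_ + _); rewrite big_mkcond; apply: eq_bigr => k _.
by rewrite /F -/pi; case: (_ \in _).
Qed.

(** * The quadratic form of a permutation and its polar form *)

Section QuadraticForm.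

Variables (n : nat) (sigma : 'S_n).

Definition arf_form (x : 'rV[bool]_n) : bool :=
  \sum_i x 0 i +
  \sum_(i < n) \sum_(j < n) (i < j)%N * ((sigma i < sigma j)%N * (x 0 i * x 0 j)).

Definition noncrossing (i j : 'I_n) : bool :=
  (i != j) && ((i < j)%N == (sigma i < sigma j)%N).

Definition arf_bilin (x y : 'rV[bool]_n) : bool :=
  \sum_i \sum_j noncrossing i j * (x 0 i * y 0 j).

Lemma sum_noncrossing (f g : 'I_n -> bool) :
  \sum_i \sum_j noncrossing i j * (f i * g j) =
  \sum_(i < n) \sum_(j < n)
     (i < j)%N * ((sigma i < sigma j)%N * (f i * g j + g i * f j)).
Proof.
under [RHS]eq_bigr do under eq_bigr do rewrite 2!mulrDr.
under [RHS]eq_bigr do rewrite big_split /=.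
rewrite [RHS]big_split /= [X in _ = _ + X]exchange_big /= -big_split.
apply: eq_bigr => i _; rewrite -big_split; apply: eq_bigr => j _ /=.
rewrite [g j * f i]mulrC !mulrA -mulrDl -mulrDl /noncrossing; congr (_ * _ * _).
case: (eqVneq i j) => [->|ij]; first by rewrite ltnn.
have : sigma i != sigma j by rewrite (inj_eq perm_inj).
move: ij; rewrite -!val_eqE /=.
by case: (ltngtP i j) => // _ _; case: ltngtP.
Qed.

Lemma arf_formD x y :
  arf_form (x + y) = arf_form x + arf_form y + arf_bilin x y.
Proof.
rewrite /arf_bilin sum_noncrossing /arf_form.
under eq_bigr do rewrite mxE; rewrite big_split /=.
rewrite addrACA -!addrA; congr (_ + (_ + _)).
rewrite -!big_split; apply: eq_bigr => i _ /=.
rewrite -!big_split; apply: eq_bigr => j _ /=; rewrite !mxE -!mulrDr.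
congr (_ * (_ * _)).
by case: (x 0 i); case: (y 0 i); case: (x 0 j); case: (y 0 j).
Qed.

Lemma arf_form0 : arf_form 0 = 0.
Proof.
rewrite /arf_form !big1 // => i _; last by rewrite mxE.
by rewrite big1 // => j _; rewrite !mxE !mulr0.
Qed.

Lemma arf_bilinDl x y z : arf_bilin (x + y) z = arf_bilin x z + arf_bilin y z.
Proof.
rewrite /arf_bilin -big_split; apply: eq_bigr => i _; rewrite -big_split.
by apply: eq_bigr => j _; rewrite mxE mulrDl mulrDr.
Qed.

(** Over F_2, [noncrossing j i] is [1 + (i == j) + (i < j) + (sigma i < sigma j)]. This turns the
    equations of the radical into relations between prefix sums on the two boundaries. *)
Lemma sum_noncrossing_row (f : 'I_n -> bool) j :
  \sum_i noncrossing j i * f i =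
  \sum_i f i + f j + \sum_(i < n) (i < j)%N * f i +
  \sum_(i < n) (sigma i < sigma j)%N * f i.
Proof.
have -> : f j = \sum_i (i == j) * f i.
  rewrite (bigD1 j) //= eqxx mul1r big1 ?addr0 // => i /negPf->.
  by rewrite mul0r.
rewrite -!big_split; apply: eq_bigr => i _ /=.
rewrite -[X in X + _ + _ + _]mul1r -!mulrDl; congr (_ * _).
rewrite /noncrossing eq_sym; case: (eqVneq i j) => [->|ij]; first by rewrite !ltnn.
have : sigma i != sigma j by rewrite (inj_eq perm_inj).
move: ij; rewrite -!val_eqE /=.
by case: (ltngtP i j) => // _ _; case: ltngtP.
Qed.

Lemma arf_bilin_noncrossing x y :
  arf_bilin y x = \sum_j y 0 j * \sum_i noncrossing j i * x 0 i.
Proof.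
rewrite /arf_bilin; apply: eq_bigr => i _; rewrite mulr_sumr.
by apply: eq_bigr => j _; rewrite mulrCA.
Qed.

Lemma sum_pairs_perm_order (b : 'I_n -> bool) :
  \sum_(i < n) \sum_(j < n) (sigma i < sigma j)%N * (b i * b j) =
  \sum_(i < n) \sum_(j < n) (i < j)%N * (b i * b j).
Proof.
apply: sum_pairs_reorder => [i|i j|i j ij _]; rewrite ?ltnn 1?mulrC //.
have : sigma i != sigma j by rewrite (inj_eq perm_inj).
by move: ij; rewrite -!val_eqE /=; 
  case: (ltngtP i j) => // _ _; case: ltngtP.
Qed.

Lemma sum_pairs_exchange_orders (b : 'I_n -> bool) :
  \sum_(i < n) \sum_(j < n) (sigma i < sigma j)%N * ((i < j)%N * (b i * b j)) =
  \sum_(i < n) \sum_(j < n) (i < j)%N * ((sigma i < sigma j)%N * (b i * b j)).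
Proof. by apply: eq_bigr => i _; apply: eq_bigr => j _; rewrite mulrCA. Qed.

End QuadraticForm.

(** * Functions on the gaps of a boundary *)

Section Gaps.

Variable n : nat.
Implicit Types (i : 'I_n) (k : 'I_n.+1) (F : 'I_n.+1 -> bool).

Lemma ltn_lift_max i k : (lift ord_max i < k)%N = (i < k)%N.
Proof. by rewrite lift_max. Qed.

Lemma sum_lift_max F : \sum_k F k = \sum_i F (lift ord_max i) + F ord_max.
Proof. by rewrite (bigD1_ord ord_max) //= addrC. Qed.

Lemma sum_lift0 F : \sum_k F k = F ord0 + \sum_i F (lift ord0 i).
Proof. exact: big_ord_recl. Qed.

Lemma sum_prefix F k :
  \sum_(i < n) (i < k)%N * (F (lift ord_max i) + F (lift ord0 i)) = F ord0 + F k.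
Proof.
pose f m : bool := F (inord m).
have -> : \sum_(i < n) (i < k)%N * (F (lift ord_max i) + F (lift ord0 i)) =
          \sum_(i < k) (f i.+1 - f i).
  rewrite (big_ord_widen n (fun m => f m.+1 - f m)) ?leq_ord //.
  rewrite [RHS]big_mkcond; apply: eq_bigr => i _.
  have -> : lift ord_max i = inord i.
    by apply: ord_inj; rewrite lift_max inordK // ltnS ltnW.
  have -> : lift ord0 i = inord i.+1 by apply: val_inj; rewrite /= inordK // ltnS.
  by rewrite -/(f i) -/(f i.+1); case: (_ < _)%N; case: (f i); case: (f _).
rewrite -(big_mkord xpredT (fun m => f m.+1 - f m)) telescope_sumr //.
have -> : f k = F k by rewrite /f inord_val.
have -> : f 0%N = F ord0 by congr F; apply: val_inj; rewrite /= inordK.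
by case: (F k); case: (F ord0).
Qed.

(** Both sides compute the sum of [F k * F m] over all gaps [m < k]: the left one splits off
    [k = 0], the right one splits off [k = n]. *)
Lemma sum_lt_product F :
  \sum_(l < n) F (lift ord0 l) * \sum_(m < n) (m < l)%N * F (lift ord_max m) +
  \sum_l F (lift ord0 l) * F (lift ord_max l) =
  \sum_(m < n) \sum_(l < n) (m < l)%N * (F (lift ord_max m) * F (lift ord_max l)) +
  F ord_max * \sum_l F (lift ord_max l).
Proof.
transitivity (\sum_(k < n.+1) F k * \sum_(m < n.+1) (m < k)%N * F m).
  rewrite (sum_lift0 (fun k => F k * _)) [X in F ord0 * X]big1; last first.
    by move=> m _; rewrite ltn0 mul0r.
  rewrite mulr0 add0r -big_split; apply: eq_bigr => l _.
  rewrite [LHS]/= -mulrDr; congr (_ * _).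
  rewrite (sum_lift_max (fun m => _ * F m)) [(ord_max < _)%N]ltnNge.
  rewrite (leq_ord (lift ord0 l)) mul0r addr0.
  rewrite [in RHS](eq_bigr (fun m : 'I_n => (m < l)%N * F (lift ord_max m)
    + (m == l) * F (lift ord_max m))); last first.
    move=> m _; rewrite -mulrDl; congr (_ * _).
    rewrite ltn_lift_max lift0 ltnS -val_eqE /=.
    by case: ltngtP.
  rewrite big_split; congr (_ + _); rewrite (bigD1 l) //= eqxx mul1r.
  by rewrite big1 ?addr0 // => m /negPf->; rewrite mul0r.
rewrite (sum_lift_max (fun k => F k * _)); congr (_ + _ * _).
  under eq_bigr do rewrite mulr_sumr.
  rewrite exchange_big (sum_lift_max (fun m => \sum_(l < n) _ )).
  rewrite [X in _ + X]big1 ?addr0 => [|l _]; last first.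
    by rewrite lift_max ltnNge ltnW ?ltn_ord // mul0r mulr0.
  apply: eq_bigr => m _; apply: eq_bigr => l _.
  by rewrite !lift_max mulrCA [F _ * F _]mulrC.
rewrite (sum_lift_max (fun m => _ * F m)) ltnn mul0r addr0.
by apply: eq_bigr => m _; rewrite lift_max ltn_ord mul1r.
Qed.

(** The last gap is sent to 0, hence is inverted with every other gap; these pairs give the extra
    product. *)
Lemma sum_inversions_lift_perm (t : 'S_n) F
    (tau := lift_perm ord_max ord0 t) :
  \sum_(k < n.+1) \sum_(l < n.+1)
     (k < l)%N * (F k * F l * (1 + (tau k < tau l)%N)) =
  \sum_(i < n) \sum_(j < n)
     (i < j)%N * (F (lift ord_max i) * F (lift ord_max j) * (1 + (t i < t j)%N)) +
  F ord_max * \sum_i F (lift ord_max i).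
Proof.
rewrite (sum_lift_max (fun k => \sum_(l < n.+1) _)).
rewrite [X in _ + X = _]big1 ?addr0 => [|l _]; last first.
  by rewrite ltnNge -ltnS ltn_ord mul0r.
rewrite mulr_sumr -big_split; apply: eq_bigr => i _; rewrite [RHS]/=.
rewrite (sum_lift_max (fun l => _ * (_ * F l * _))); congr (_ + _).
  apply: eq_bigr => j _; rewrite !lift_max /tau !lift_perm_lift.
  by rewrite !lift0 ltnS.
rewrite lift_max ltn_ord /tau lift_perm_id ltn0 addr0 mulr1 mul1r.
exact: mulrC.
Qed.

End Gaps.

(** * The gap permutation and its invariant functions *)

Section GapPermutation.

Variables (n : nat) (sigma : 'S_n).

(* The gaps on either side of edge [i] on a boundary are [lift ord_max i] (of
   value [i]) and [lift ord0 i] (of value [i + 1]).  Following a crossing edge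
   upwards from the left of [i] leads to the right of [sigma i], and downwards
   likewise; the outer values [ord_max |-> ord0] encode the -1 mark and the arc
   closing the rank path. *)
Definition gap_up : 'S_n.+1 := lift_perm ord_max ord0 sigma.
Definition gap_down : 'S_n.+1 := lift_perm ord_max ord0 sigma^-1%g.
Definition gap_perm : 'S_n.+1 := (gap_up * gap_down)%g.

Definition gap_diff (F : 'I_n.+1 -> bool) : 'rV[bool]_n :=
  \row_i (F (lift ord_max i) + F (lift ord0 i)).

Section InvariantFunction.

Variable F : 'I_n.+1 -> bool.
Hypothesis Fpi : forall k, F (gap_perm k) = F k.
(** [F] transported to the top boundary. Of the four dictionary lemmas below, [top_black] and
    [top_last] only unfold [gap_down], while [top_white] and [top_first] express the invariance of
    [F]. *)
Let G l := F (gap_down l).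

Lemma top_white i : G (lift ord0 (sigma i)) = F (lift ord_max i).
Proof. by rewrite -[RHS]Fpi permM /gap_up lift_perm_lift. Qed.

Lemma top_black i : G (lift ord_max (sigma i)) = F (lift ord0 i).
Proof. by rewrite /G lift_perm_lift permK. Qed.

Lemma top_first : G ord0 = F ord_max.
Proof. by rewrite -[RHS]Fpi permM /gap_up lift_perm_id. Qed.

Lemma top_last : G ord_max = F ord0.
Proof. by rewrite /G lift_perm_id. Qed.

Lemma sum_top_prefix (k : 'I_n.+1) :
  \sum_(i < n) (sigma i < k)%N * gap_diff F 0 i = F ord_max + G k.
Proof.
rewrite -top_first -sum_prefix [RHS](reindex_inj (@perm_inj _ sigma)) /=.
by apply: eq_bigr => i _; rewrite mxE top_white top_black addrC.
Qed.

Lemma sum_bottom_prefix (k : 'I_n.+1) :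
  \sum_(i < n) (i < k)%N * gap_diff F 0 i = F ord0 + F k.
Proof. by rewrite -sum_prefix; apply: eq_bigr => i _; rewrite mxE. Qed.

Lemma sum_gap_diff : \sum_i gap_diff F 0 i = F ord0 + F ord_max.
Proof.
rewrite -sum_bottom_prefix; apply: eq_bigr => i _.
by rewrite ltn_ord mul1r.
Qed.

(** In row [j], the total, the entry and the two prefix sums telescope to values of [F] at the two
    outer gaps and at the two sides of [j], and each value occurs twice. *)
Lemma gap_diff_radical y : arf_bilin sigma y (gap_diff F) = 0.
Proof.
rewrite arf_bilin_noncrossing big1 // => j _.
rewrite sum_noncrossing_row sum_gap_diff.
have := sum_top_prefix (lift ord_max (sigma j)); rewrite lift_max => ->.
have := sum_bottom_prefix (lift ord_max j); rewrite lift_max => ->.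
rewrite mxE top_black; case: (y 0 j); case: (F ord0); case: (F ord_max);
by case: (F (lift ord_max j)); case: (F (lift ord0 j)).
Qed.

End InvariantFunction.

(** The inversion identity for [gap_up] and [gap_down] evaluates the part of the form that depends
    on the order of [sigma]; the other pair sums cancel. The final term removes the outer gap
    [l = 0] from the sum. *)
Lemma arf_form_orbit x (F := fun k => k \in porbit gap_perm x) :
  arf_form sigma (gap_diff F) =
  1 + \sum_l F (gap_down (lift ord_max l)) + F (gap_down ord0).
Proof.
have Fpi k : F (gap_perm k) = F k.
  by rewrite /F -!eq_porbit_mem -[gap_perm k]/((gap_perm ^+ 1)%g k) porbit_perm.
pose G l := F (gap_down l); pose a i := F (lift ord_max i).
pose b i := F (lift ord0 i).
have bE i : G (lift ord_max (sigma i)) = b i := top_black F i.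
have aE i : G (lift ord0 (sigma i)) = a i := top_white Fpi i.
have GnE : G ord_max = F ord0 := top_last F.
have SbE : \sum_l G (lift ord_max l) = \sum_i b i.
  by rewrite (reindex_inj (@perm_inj _ sigma)); apply: eq_bigr => i _; rewrite bE.
have : \sum_(k < n.+1) \sum_(l < n.+1)
         (k < l)%N * (F k * F l * (1 + (gap_up k < gap_up l)%N)) +
       \sum_(k < n.+1) \sum_(l < n.+1)
         (k < l)%N * (G k * G l * (1 + (gap_down k < gap_down l)%N)) =
       1 + \sum_k F k.
  exact: sum_inversions_porbit_mul.
rewrite (sum_inversions_lift_perm sigma F).
rewrite (sum_inversions_lift_perm sigma^-1%g G) SbE GnE.
rewrite (sum_lift_max F).
have -> : \sum_(i < n) \sum_(j < n) (i < j)%N *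
    (G (lift ord_max i) * G (lift ord_max j) *
     (1 + (sigma^-1%g i < sigma^-1%g j)%N)) =
    \sum_(i < n) \sum_(j < n) (i < j)%N * (b i * b j) +
    \sum_(i < n) \sum_(j < n)
      (i < j)%N * ((sigma i < sigma j)%N * (b i * b j)).
  rewrite (reindex_inj (@perm_inj _ sigma)) /=.
  under eq_bigr do rewrite (reindex_inj (@perm_inj _ sigma)) /=.
  rewrite -(sum_pairs_perm_order sigma) -sum_pairs_exchange_orders -big_split.
  apply: eq_bigr => i _ /=.
  rewrite -big_split; apply: eq_bigr => j _ /=.
  by rewrite !permK !bE -mulrDr [b i * b j * _]mulrC mulrDl mul1r.
have -> : \sum_(i < n) \sum_(j < n) (i < j)%N *
    (a i * a j * (1 + (sigma i < sigma j)%N)) =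
    \sum_(i < n) \sum_(j < n) (i < j)%N * (a i * a j) +
    \sum_(i < n) \sum_(j < n)
      (i < j)%N * ((sigma i < sigma j)%N * (a i * a j)).
  rewrite -big_split; apply: eq_bigr => i _ /=.
  rewrite -big_split; apply: eq_bigr => j _ /=.
  by rewrite -mulrDr [a i * a j * _]mulrC mulrDl mul1r.
rewrite /arf_form sum_gap_diff.
(* Expand the entries as [a + b]: the pure terms are those of the inversion identity, and the mixed
   ones run over noncrossing pairs. *)
have -> : \sum_(i < n) \sum_(j < n) (i < j)%N * ((sigma i < sigma j)%N *
    (gap_diff F 0 i * gap_diff F 0 j)) =
    \sum_(i < n) \sum_(j < n) (i < j)%N * ((sigma i < sigma j)%N * (a i * a j)) +
    \sum_(i < n) \sum_(j < n) (i < j)%N * ((sigma i < sigma j)%N * (b i * b j)) +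
    \sum_i \sum_j noncrossing sigma i j * (a i * b j).
  rewrite sum_noncrossing -!big_split; apply: eq_bigr => i _ /=.
  rewrite -!big_split; apply: eq_bigr => j _ /=; rewrite -!mulrDr !mxE.
  rewrite -/(a i) -/(a j) -/(b i) -/(b j); congr (_ * (_ * _)).
  by case: (a i); case: (a j); case: (b i); case: (b j).
have prefix_b (i : 'I_n) : \sum_(j < n) (j < i)%N * b j =
    \sum_(j < n) (j < i)%N * a j + F ord0 + a i.
  have := sum_prefix F (lift ord_max i); rewrite lift_max -/(a i).
  under eq_bigr do rewrite mulrDr; rewrite big_split /= -/a -/b.
  move: (\sum_(j < n) _ * b j) (\sum_(j < n) _ * a j) (F ord0) (a i).
  by do 4!case.
have -> : \sum_i \sum_j noncrossing sigma i j * (a i * b j) =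
    (\sum_i a i) * (\sum_i b i) + \sum_i a i * b i +
    (\sum_(i < n) \sum_(j < n) (i < j)%N * (a i * a j) +
     F ord0 * \sum_i a i + \sum_i a i) +
    (\sum_(i < n) a i * \sum_(j < n) (sigma j < sigma i)%N * b j).
  transitivity (\sum_i a i * \sum_j noncrossing sigma i j * b j).
    apply: eq_bigr => i _; rewrite mulr_sumr; apply: eq_bigr => j _.
    by rewrite mulrCA.
  under eq_bigr do rewrite sum_noncrossing_row prefix_b !mulrDr.
  rewrite !big_split /=; congr (_ + _ + (_ + _ + _) + _).
  - by rewrite mulr_suml.
  - under eq_bigr do rewrite mulr_sumr.
    rewrite exchange_big; apply: eq_bigr => i _; apply: eq_bigr => j _ /=.
    by rewrite mulrCA [a j * _]mulrC.
  - by rewrite mulr_sumr; apply: eq_bigr => i _; rewrite mulrC.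
  - by apply: eq_bigr => i _; case: (a i).
(* This is [sum_lt_product] on the top boundary, where [b] is read to the left of an edge and [a] to
   its right. *)
have -> : \sum_(i < n) a i * (\sum_(j < n) (sigma j < sigma i)%N * b j) =
    \sum_(i < n) \sum_(j < n) (i < j)%N * (b i * b j) +
    F ord0 * \sum_i b i + \sum_i a i * b i.
  have := sum_lt_product G; rewrite SbE GnE.
  rewrite (reindex_inj (@perm_inj _ sigma)) /=.
  under eq_bigr do rewrite (reindex_inj (@perm_inj _ sigma)) /= aE.
  under eq_bigr do under eq_bigr do rewrite bE.
  rewrite [X in _ + X = _ -> _](reindex_inj (@perm_inj _ sigma)) /=.
  under [X in _ + X = _ -> _]eq_bigr do rewrite aE bE.
  rewrite [X in _ = X + _ -> _](reindex_inj (@perm_inj _ sigma)) /=.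
  under [X in _ = X + _ -> _]eq_bigr do rewrite (reindex_inj (@perm_inj _ sigma)) /=.
  under [X in _ = X + _ -> _]eq_bigr do under eq_bigr do rewrite !bE.
  rewrite sum_pairs_perm_order.
  move: (\sum_(i < n) a i * \sum_(j < n) _) (\sum_(i < n) a i * b i).
  move: (\sum_(i < n) \sum_(j < n) _) (F ord0) (\sum_i b i).
  by do 5!case.
(* Both sides are the sum of [F] over all gaps. With this relation the goal becomes a Boolean
   identity, checked by cases. *)
have SE : \sum_i a i + F ord_max = F ord0 + \sum_i b i.
  by rewrite -sum_lift_max sum_lift0.
rewrite (top_first Fpi).
have -> : \sum_i F (lift ord_max i) = \sum_i a i by [].
move: SE; move: (\sum_i a i * b i) => E.
move: (\sum_i a i) (\sum_i b i) (F ord0) (F ord_max) => Sa Sb f0 fn.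
move: (\sum_(i < n) \sum_(j < n) _ * (_ * (a i * a j))).
move: (\sum_(i < n) \sum_(j < n) _ * (_ * (b i * b j))).
move: (\sum_(i < n) \sum_(j < n) _ * (a i * a j)).
move: (\sum_(i < n) \sum_(j < n) _ * (b i * b j)).
by case: E; case: Sa; case: Sb; case: f0; case: fn; do 4!case.
Qed.

End GapPermutation.

(** * The radical and the values of the form on it *)

Section Radical.

Variables (n : nat) (sigma : 'S_n).

Let pi := gap_perm sigma.

Definition arf_radical : {set 'rV[bool]_n} :=
  [set z | [forall y, ~~ arf_bilin sigma y z]].

Definition orbit_diff (K : {set {set 'I_n.+1}}) : 'rV[bool]_n :=
  gap_diff (fun k => porbit pi k \in K).

Lemma porbit_gap_perm k : porbit pi (pi k) = porbit pi k.
Proof. by rewrite -{1}[pi k]/((pi ^+ 1)%g k) porbit_perm. Qed.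

Lemma orbit_diff_radical K y : arf_bilin sigma y (orbit_diff K) = 0.
Proof. by apply: gap_diff_radical => k; rewrite porbit_gap_perm. Qed.

Lemma orbit_diff_in K : orbit_diff K \in arf_radical.
Proof. by rewrite inE; apply/forallP => y; rewrite orbit_diff_radical. Qed.

Lemma orbit_diff_sum K : orbit_diff K = \sum_(O in K) orbit_diff [set O].
Proof.
have memE k : (porbit pi k \in K) = \sum_(O in K) (porbit pi k \in [set O]) :> bool.
  case: (boolP (porbit pi k \in K)) => kK; last first.
    rewrite big1 // => O OK; rewrite inE; apply/negbTE/eqP => kO.
    by rewrite kO OK in kK.
  rewrite (bigD1 _ kK) /= inE eqxx big1 // => O /andP[_ Ok].
  by rewrite inE eq_sym; apply/negbTE.
apply/rowP => i; rewrite summxE mxE !memE -big_split.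
by apply: eq_bigr => O _; rewrite mxE.
Qed.

Lemma arf_form_orbit_diff K :
  arf_form sigma (orbit_diff K) =
  \sum_(O in K) arf_form sigma (orbit_diff [set O]).
Proof.
rewrite orbit_diff_sum -!big_enum /=; elim: (enum K) => [|O r IHr].
  by rewrite !big_nil arf_form0.
by rewrite !big_cons addrC arf_formD orbit_diff_radical addr0 IHr addrC.
Qed.

(** Modulo 2 the last term cancels the summand [l = 0]. Only gaps strictly between two positions of
    the top boundary count, one for each top arc. *)
Definition top_parity (O : {set 'I_n.+1}) : bool :=
  \sum_l (gap_down sigma (lift ord_max l) \in O) + (gap_down sigma ord0 \in O).

Lemma arf_form_orbit_diff1 O :
  O \in porbits pi -> arf_form sigma (orbit_diff [set O]) = 1 + top_parity O.
Proof.
case/imsetP => x _ ->; rewrite /top_parity addrA -arf_form_orbit.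
congr arf_form; apply/rowP => i.
by rewrite !mxE !inE !eq_porbit_mem.
Qed.

Lemma orbit_diff_porbits : orbit_diff (porbits pi) = 0.
Proof. by apply/rowP => i; rewrite !mxE !imset_f. Qed.

(** The union of all orbits has a constant indicator, hence zero differences, and the form is
    additive on the radical. Each orbit of even length contributes 1. *)
Lemma sum_top_parity : \sum_(O in porbits pi) (1 + top_parity O) = 0.
Proof.
rewrite -[RHS](arf_form0 sigma) -orbit_diff_porbits arf_form_orbit_diff.
by apply: eq_bigr => O /arf_form_orbit_diff1.
Qed.

Let outer := porbit pi ord0.

(** Leaving out the orbit of gap 0 normalises the indicator to vanish there; prefix sums of the
    differences then recover it. *)
Lemma orbit_diff_inj :
  {in powerset (porbits pi :\ outer) &, injective orbit_diff}.
Proof.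
have sub0 K : K \in powerset (porbits pi :\ outer) -> porbit pi ord0 \notin K.
  by rewrite inE => /subsetP sK; apply/negP => /sK; rewrite !inE eqxx.
move=> K K' PK PK' eqd.
have eqF k : (porbit pi k \in K) = (porbit pi k \in K').
  have := sum_prefix (fun k => porbit pi k \in K) k.
  have := sum_prefix (fun k => porbit pi k \in K') k.
  rewrite /= (negPf (sub0 K PK)) (negPf (sub0 K' PK')) !add0r => <- <-.
  apply: eq_bigr => i _; congr (_ * _).
  by move/rowP/(_ i): eqd; rewrite !mxE.
have subK L : L \in powerset (porbits pi :\ outer) -> {subset L <= porbits pi}.
  by rewrite inE => /subsetP sL O /sL; rewrite inE => /andP[].
apply/setP => O; apply/idP/idP => OK.
  by have /imsetP[k _ Ok] := subK K PK O OK; rewrite Ok in OK *; rewrite -eqF.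
by have /imsetP[k _ Ok] := subK K' PK' O OK; rewrite Ok in OK *; rewrite eqF.
Qed.

Lemma radical_orbit_diff z :
  z \in arf_radical ->
  exists2 K, K \in powerset (porbits pi :\ outer) & z = orbit_diff K.
Proof.
rewrite inE => /forallP radz.
have rz j : \sum_i z 0 i + z 0 j + \sum_(i < n) (i < j)%N * z 0 i +
    \sum_(i < n) (sigma i < sigma j)%N * z 0 i = 0.
  (* Testing against basis vectors gives one linear equation for each edge. *)
  rewrite -sum_noncrossing_row; apply/negbTE; move: (radz (delta_mx 0 j)).
  rewrite arf_bilin_noncrossing (bigD1 j) //= [X in _ + X]big1 => [|i ij]; last first.
    by rewrite mxE (negPf ij) andbF mul0r.
  by rewrite mxE !eqxx mul1r addr0.
have ltSr (h : 'I_n -> nat) (j : 'I_n) : injective h ->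
    \sum_(i < n) (h i < (h j).+1)%N * z 0 i =
    \sum_(i < n) (h i < h j)%N * z 0 i + z 0 j.
  move=> injh; rewrite [RHS]addrC (bigD1 j) //= [in RHS](bigD1 j) //=.
  rewrite ltnS leqnn ltnn mul1r mul0r add0r; congr (_ + _).
  apply: eq_bigr => i ij; rewrite ltnS leq_eqVlt.
  by rewrite (inj_eq injh) (negPf ij).
have inj_sigma : injective (fun i => nat_of_ord (sigma i)).
  by move=> i j /ord_inj /perm_inj.
(* [F] integrates [z] along the bottom and [G] along the top. The total added to [G] matches the
   outer gaps [ord_max] and [ord0], and the equations [rz] say that the crossing edges respect [F]
   and [G]. *)
pose F (k : 'I_n.+1) : bool := \sum_(i < n) (i < k)%N * z 0 i.
pose G (l : 'I_n.+1) : bool :=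
  \sum_i z 0 i + \sum_(i < n) (sigma i < l)%N * z 0 i.
have total (h : 'I_n -> 'I_n) : \sum_(i < n) (h i < n)%N * z 0 i = \sum_i z 0 i.
  by apply: eq_bigr => i _; rewrite ltn_ord mul1r.
have none (h : 'I_n -> nat) : \sum_(i < n) (h i < 0)%N * z 0 i = 0.
  by rewrite big1 // => i _; rewrite mul0r.
have GF k : G (gap_up sigma k) = F k.
  rewrite /F /G; case: (unliftP ord_max k) => [j|] ->.
    rewrite lift_perm_lift lift0 lift_max (ltSr _ j inj_sigma).
    move: (rz j); case: (\sum_i z 0 i); case: (z 0 j);
    by case: (\sum_(i < n) _); case: (\sum_(i < n) _).
  by rewrite lift_perm_id none (total id) addr0.
have FG l : F (gap_down sigma l) = G l.
  rewrite /F /G; case: (unliftP ord_max l) => [j'|] ->.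
    rewrite -(permKV sigma j'); move: (sigma^-1%g j') => j {j'}.
    rewrite lift_perm_lift permK lift0 lift_max (ltSr _ j (@ord_inj n)).
    move: (rz j); case: (\sum_i z 0 i); case: (z 0 j);
    by case: (\sum_(i < n) _); case: (\sum_(i < n) _).
  by rewrite lift_perm_id (none id) (total sigma) addbool_self.
have Fpi k : F (pi k) = F k by rewrite /pi permM FG GF.
have Forb k k' : k' \in porbit pi k -> F k' = F k.
  case/porbitP => m ->; rewrite permX; elim: m => //= m IHm.
  by rewrite Fpi.
pose K := [set O in porbits pi | [exists k in O, F k]].
have FK k : (porbit pi k \in K) = F k.
  rewrite inE imset_f //=; apply/existsP/idP => [[k' /andP[/Forb-> //]]|Fk].
  by exists k; rewrite porbit_id.
exists K.
  rewrite inE; apply/subsetP => O OK; rewrite !inE.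
  case: (eqVneq O outer) => [OE|_]; last by move: OK; rewrite inE => /andP[].
  by move: OK; rewrite OE FK /F (none id).
apply/rowP => j; rewrite mxE !FK /F lift0 lift_max (ltSr _ j (@ord_inj n)).
by rewrite addrA addbool_self add0r.
Qed.

Lemma card_arf_radical : #|arf_radical| = (2 ^ #|porbits pi|.-1)%N.
Proof.
have -> : arf_radical = orbit_diff @: powerset (porbits pi :\ outer).
  apply/setP => z; apply/idP/imsetP => [/radical_orbit_diff[K]|[K _ ->]].
    by exists K.
  exact: orbit_diff_in.
rewrite (card_in_imset orbit_diff_inj) card_powerset.
by rewrite (cardsD1 outer (porbits pi)) imset_f.
Qed.

Lemma arf_sum_form : arf sigma = \sum_x (-1) ^+ arf_form sigma x.
Proof.
pose ind (I : {set 'I_n}) : 'rV[bool]_n := \row_i (i \in I).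
have ind_bij : bijective ind.
  exists (fun x : 'rV[bool]_n => [set i | x 0 i]) => [I | x].
    by apply/setP => i; rewrite inE mxE.
  by apply/rowP => i; rewrite mxE inE.
rewrite /arf [RHS](reindex ind) /=; last exact: onW_bij.
apply: eq_bigr => I _; rewrite -signr_odd; congr (_ ^+ _); congr nat_of_bool.
have odd_card (T : finType) (A : {set T}) : odd #|A| = \sum_y (y \in A) :> bool.
  rewrite -natr_bool -sumr_const big_mkcond.
  by apply: eq_bigr => y _; case: (y \in A).
rewrite oddD !odd_card /arf_form pair_big /=; congr (_ + _).
  by apply: eq_bigr => i _; rewrite mxE.
apply: eq_bigr => -[i j] _; rewrite inE !mxE /=.
by case: (i \in I); case: (j \in I); case: (_ < _)%N; case: (_ < _)%N.
Qed.

Lemma arf_eq0 O : O \in porbits pi -> top_parity O = 0 -> arf sigma = 0.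
Proof.
move=> /arf_form_orbit_diff1 qO even_O; rewrite arf_sum_form.
apply: (gauss_sum_eq0 (arf_formD sigma) (orbit_diff_in [set O])).
by rewrite qO even_O.
Qed.

Lemma arf_sqr :
    (forall O, O \in porbits pi -> top_parity O) ->
  arf sigma ^+ 2 = (2 ^ (n + #|porbits pi|.-1))%:R.
Proof.
move=> odd_O; rewrite arf_sum_form.
rewrite (gauss_sum_sqr (arf_formD sigma) (arf_bilinDl sigma)) => [|z].
  by rewrite -/arf_radical card_arf_radical card_mx card_bool mul1n expnD.
case/radical_orbit_diff => K; rewrite inE => /subsetP sK ->.
rewrite arf_form_orbit_diff big1 // => O /sK; rewrite inE => /andP[_ piO].
by rewrite arf_form_orbit_diff1 ?odd_O.
Qed.

End Radical.

(** * Components of the diagram as orbits of gaps *)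

Section Diagram.

Variables (n : nat) (sigma : 'S_n).
Hypothesis n_gt0 : (0 < n)%N.

Let pi := gap_perm sigma.

Definition gap (p : point n) : 'I_n.+1 :=
  if is_white p then lift ord0 (pos p) else lift ord_max (pos p).

(** Top gaps are carried down to bottom gaps, so that points of both boundaries are labelled in the
    one set on which [gap_perm] acts. *)
Definition node (p : point n) : 'I_n.+1 :=
  if is_top p then gap_down sigma (gap p) else gap p.

Let i_last : 'I_n := Ordinal (etrans (ltn_predL n) n_gt0).
Let i_first : 'I_n := Ordinal n_gt0.

Lemma lift0_last : lift ord0 i_last = ord_max.
Proof. by apply: ord_inj; rewrite lift0 /= prednK. Qed.

Lemma lift_max_first : lift ord_max i_first = ord0.
Proof. by apply: ord_inj; rewrite lift_max. Qed.

Lemma node_surj k : exists p, node p = k.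
Proof.
case: (unliftP ord_max k) => [i|] ->; first by exists (false, false, i).
by exists (false, true, i_last); rewrite -lift0_last.
Qed.

Lemma edge_porbit x y :
  edge sigma x y -> porbit pi (node x) = porbit pi (node y).
Proof.
case: x y => [[tx wx] i] [[ty wy] j]; rewrite /edge => /or4P[].
- case/and4P; rewrite /= /is_top /is_white /pos /= => /negPf-> -> /eqP-> wxy.
  rewrite /node /gap /is_top /is_white /pos /= /gap_down.
  case: wx wy wxy => [] [] // _; first by rewrite lift_perm_lift permK.
  by rewrite -(porbit_gap_perm sigma) permM /gap_up lift_perm_lift.
- case/and5P; rewrite /= /is_top /is_white /pos /= => -> -> -> /negPf-> /eqP ji.
  congr (porbit _ _); congr (gap_down _ _); rewrite /gap /is_white /pos /=.
  by apply: ord_inj; rewrite lift0 lift_max.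
- case/and5P; rewrite /= /is_top /is_white /pos /=.
  move=> /negPf-> /negPf-> -> /negPf-> /eqP ji.
  congr (porbit _ _); rewrite /node /gap /is_white /pos /=.
  by apply: ord_inj; rewrite lift0 lift_max.
- case/and5P; rewrite /= /is_top /is_white /pos /=.
  move=> -> -> /eqP iE /negPf-> /andP[/negPf-> /eqP jE].
  congr (porbit _ _); rewrite /node /gap /is_white /pos /=.
  have -> : lift ord0 i = ord_max by apply: ord_inj; rewrite lift0 iE.
  by rewrite /gap_down lift_perm_id; apply: ord_inj; rewrite lift_max.
Qed.

(** Converse tool to [edge_porbit]: a function constant along edges cannot separate points whose
    nodes share an orbit. Applied to the indicator of a component in [connect_node], it yields
    connectedness without building paths. *)
Lemma edge_invariant_node (f : point n -> bool) :
    (forall x y, edge sigma x y -> f x = f y) ->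
  exists2 F : 'I_n.+1 -> bool,
    forall k, F (pi k) = F k & forall x, f x = F (node x).
Proof.
(* A gap is read at the black point on its right; the last gap has none and is read at the white
   point of the last position. *)
move=> fE; pose Fs t k :=
  if unlift ord_max k is Some i then f (t, false, i) else f (t, true, i_last).
have FsE p : f p = Fs (is_top p) (gap p).
  case: p => [[t [] i]]; rewrite /gap /is_top /is_white /pos /= /Fs ?liftK //.
  case: unliftP => [j|] /(congr1 val) /=.
    rewrite -[bump 0 i]/(nat_of_ord (lift ord0 i)).
    rewrite -[bump n j]/(nat_of_ord (lift ord_max j)) lift0 lift_max => ij.
    apply: fE; rewrite /edge /top_arc /bottom_arc /is_top /is_white /pos /= -ij.
    by case: t; rewrite eqxx ?orbT.
  rewrite -[bump 0 i]/(nat_of_ord (lift ord0 i)) lift0 => iE.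
  by congr (f (_, _, _)); apply: ord_inj; apply: (congr1 predn iE).
pose F := Fs false; pose G := Fs true.
have GF0 i : G (lift ord0 (sigma i)) = F (lift ord_max i).
  rewrite -[LHS](FsE (true, true, _)) -[RHS](FsE (false, false, _)).
  by apply/esym/fE; rewrite /edge /crossing_edge /= eqxx.
have GFn i : G (lift ord_max (sigma i)) = F (lift ord0 i).
  rewrite -[LHS](FsE (true, false, _)) -[RHS](FsE (false, true, _)).
  by apply/esym/fE; rewrite /edge /crossing_edge /= eqxx.
have Gn : G ord_max = F ord0.
  transitivity (f (true, true, i_last)); first by rewrite FsE /gap /= lift0_last.
  transitivity (f (false, false, i_first)); last first.
    by rewrite FsE /gap /= lift_max_first.
  by apply: fE; rewrite /edge /minus_one_mark /= prednK // eqxx.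
(* The rank path ends at [n_w^-]: the other links force both boundaries to carry
   the same total, whence the values of the two free ends agree. *)
have G0 : G ord0 = F ord_max.
  have S0 : \sum_i G (lift ord0 i) = \sum_i F (lift ord_max i).
    by rewrite (reindex_inj (@perm_inj _ sigma)); apply: eq_bigr => i _; rewrite GF0.
  have Sn : \sum_i G (lift ord_max i) = \sum_i F (lift ord0 i).
    by rewrite (reindex_inj (@perm_inj _ sigma)); apply: eq_bigr => i _; rewrite GFn.
  have := sum_lift_max F; rewrite sum_lift0 -Sn -S0.
  have := sum_lift_max G; rewrite sum_lift0 Gn.
  move: (\sum_i G (lift ord0 i)) (\sum_i G (lift ord_max i)).
  by case: (G ord0); case: (F ord0); case: (F ord_max) => [] [] [].
have FG l : F (gap_down sigma l) = G l.
  rewrite /gap_down; case: (unliftP ord_max l) => [i|] ->.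
    by rewrite lift_perm_lift -GFn permKV.
  by rewrite lift_perm_id Gn.
exists F => [k|x]; last by rewrite FsE /node; case: (is_top x); rewrite ?FG.
rewrite /pi permM FG /gap_up; case: (unliftP ord_max k) => [i|] ->.
  by rewrite lift_perm_lift GF0.
by rewrite lift_perm_id G0.
Qed.

Lemma connect_node x y :
  connect (adjacent sigma) x y = (node y \in porbit pi (node x)).
Proof.
apply/idP/idP => [/connectP[r]|].
  rewrite -eq_porbit_mem eq_sym; elim: r x => [|z r IHr] x /=; first by move=> _ ->.
  case/andP=> /orP xz zr /(IHr _ zr) /eqP<-; apply/eqP.
  by case: xz => /edge_porbit.
have [u v uv | F Fpi FE] := @edge_invariant_node (connect (adjacent sigma) x).
  have uv' : connect (adjacent sigma) u v by apply/connect1/orP; left.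
  apply/idP/idP => [xu | xv]; first exact: connect_trans uv'.
  by apply: connect_trans xv _; apply/connect1/orP; right.
case/porbitP => m yE; rewrite FE yE permX.
have -> : F (iter m pi (node x)) = F (node x).
  by elim: m {yE} => //= m IHm; rewrite Fpi.
by rewrite -FE connect0.
Qed.

Definition orbit_points (O : {set 'I_n.+1}) : {set point n} :=
  [set p | node p \in O].

Lemma orbit_points_inj : injective orbit_points.
Proof.
move=> O O' /setP eqO; apply/setP => k; have [p <-] := node_surj k.
by have := eqO p; rewrite !inE.
Qed.

Lemma components_porbits : components sigma = orbit_points @: porbits pi.
Proof.
have compE x : [set y in [set: point n] | connect (adjacent sigma) x y] =
    orbit_points (porbit pi (node x)).
  by apply/setP => y; rewrite !inE connect_node.
apply/setP => C; apply/imsetP/imsetP => [[x _ ->] | [_ /imsetP[k _ ->] ->]].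
  by exists (porbit pi (node x)); rewrite ?compE // imset_f.
by have [x <-] := node_surj k; exists x; rewrite ?compE.
Qed.

Lemma rank_path_porbit :
  rank_path sigma = orbit_points (porbit pi (node (true, false, i_first))).
Proof.
apply/setP => y; rewrite !inE -connect_node; apply/existsP/idP => [[x] | cxy].
  case: x => [[tx wx] i] /andP[/and3P[]]; rewrite /is_top /is_white /pos /=.
  move=> -> /negPf-> /eqP i0.
  by have -> : i = i_first by apply: ord_inj.
by exists (true, false, i_first); rewrite /rank_path_start /=.
Qed.

Lemma odd_path_length O : odd (path_length (orbit_points O)) = top_parity sigma O.
Proof.
(* A top arc is indexed by its right end [j > 0]; the truncated value of [prd] at 0 is excluded by
   [A]. *)
pose prd (j : 'I_n) : 'I_n := Ordinal (leq_ltn_trans (leq_pred j) (ltn_ord j)).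
pose arc (j : 'I_n) : point n * point n := ((true, true, prd j), (true, false, j)).
pose A := [set j : 'I_n | (0 < j)%N && (gap_down sigma (lift ord_max j) \in O)].
have arc_inj : injective arc by move=> i j [_ ->].
have -> : path_length (orbit_points O) = #|A|.
  rewrite -(card_imset _ arc_inj); apply: eq_card => e; rewrite inE.
  apply/and3P/imsetP => [[] | [j]].
    case: e => [[[t w] i] [[t' w'] j]] /=; rewrite !inE /node /gap.
    move=> _ jO /and5P[]; rewrite /is_top /is_white /pos /= in jO *.
    move=> tt tt' ww /negPf ww' /eqP ji; rewrite tt tt' ww ww' in jO *.
    exists j; first by rewrite inE ji.
    by congr (_, _, _, _); apply: ord_inj; rewrite /= ji.
  rewrite inE => /andP[j_gt0 jO] ->; split; rewrite /= ?inE //.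
    suff -> : node (true, true, prd j) = gap_down sigma (lift ord_max j) by [].
    by congr (gap_down _ _); apply: ord_inj; rewrite lift0 lift_max /= prednK.
  by rewrite /top_arc /is_top /is_white /pos /= prednK.
rewrite -natr_bool -sumr_const big_mkcond /top_parity.
rewrite [in RHS](bigD1 i_first) //= lift_max_first [RHS]addrC addrA.
rewrite addbool_self add0r (bigD1 i_first) //= inE ltnn add0r.
apply: eq_bigr => j j0; rewrite inE lt0n.
by rewrite -val_eqE /= in j0; rewrite j0 /=; case: (_ \in O).
Qed.

(** The rank path is itself a component, so adding it back to the cycles gives exactly one entry per
    orbit. *)
Lemma perm_cycle_invariant_list :
  perm_eq (cycle_invariant_list sigma)
          [seq path_length (orbit_points B) | B <- enum (porbits pi)].
Proof.
rewrite perm_rcons (map_comp (@path_length n) orbit_points).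
apply: (@perm_map _ _ (@path_length n) (rank_path sigma :: enum (cycles sigma))).
have rankC : rank_path sigma \in components sigma.
  by rewrite components_porbits rank_path_porbit !imset_f.
apply: uniq_perm.
- by rewrite /= mem_enum enum_uniq !inE eqxx.
- by rewrite (map_inj_uniq orbit_points_inj) enum_uniq.
- move=> C; rewrite inE mem_enum !inE.
  transitivity (C \in components sigma).
    by case: (eqVneq C (rank_path sigma)) => [->|].
  rewrite components_porbits; apply/imsetP/mapP => [] [O OP ->]; exists O => //.
    by rewrite mem_enum.
  by rewrite mem_enum in OP.
Qed.

Lemma size_cycle_type : size (cycle_type sigma) = #|porbits pi|.-1.
Proof.
have /perm_size := perm_cycle_invariant_list.
by rewrite size_rcons; set k := size (cycle_type _); rewrite size_map -cardE => <-.
Qed.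

End Diagram.

(** * Square roots of powers of two, and the theorem *)

Lemma sqr_pow2 (a : int) m :
  a ^+ 2 = (2 ^ m)%:R -> ~~ odd m /\ (a = 2 ^+ m./2 \/ a = - 2 ^+ m./2).
Proof.
move=> a2; have even_m : ~~ odd m.
  (* Comparing 2-adic valuations makes [m] twice the valuation of [a]; this is what makes the
     exponent in the theorem an integer. *)
  have /(congr1 (logn 2)) : (absz a ^ 2)%N = (2 ^ m)%N.
    by rewrite -abszX a2 natz.
  by rewrite lognX pfactorK // => <-; rewrite oddM.
have : (a == 2 ^+ m./2) || (a == - 2 ^+ m./2).
  rewrite -eqf_sqr a2 -exprM natrX muln2.
  by rewrite -[m in 2 ^+ m](odd_double_half m) (negPf even_m).
by case/orP=> /eqP ->; split=> //; [left | right].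
Qed.

Local Close Scope ring_scope.

Theorem mainTheorem2 (n : nat) (sigma : 'S_n) (hn : (2 <= n)%N)
    (hirr : irreducible_perm sigma) :
  ~~ odd (count (fun m => ~~ odd m) (cycle_invariant_list sigma)) /\
  (all odd (cycle_invariant_list sigma) ->
     ~~ odd (n + size (cycle_type sigma)) /\
     (arf sigma = (2 ^+ (n + size (cycle_type sigma))./2)%R \/
      arf sigma = (- 2 ^+ (n + size (cycle_type sigma))./2)%R)) /\
  (~~ all odd (cycle_invariant_list sigma) -> arf sigma = 0%R).
Proof.
have n_gt0 : (0 < n)%N by apply: ltnW.
have permL := perm_cycle_invariant_list sigma n_gt0.
rewrite (perm_all _ permL) (size_cycle_type sigma n_gt0) all_map.
split; last split.
(* An entry is even exactly when [1 + top_parity] of its orbit is 1, so the parity of the count is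
   the sum that vanishes. *)
- suff -> : odd (count (fun m => ~~ odd m) (cycle_invariant_list sigma)) =
      (\sum_(B in porbits (gap_perm sigma)) (1 + top_parity sigma B))%R.
    by rewrite sum_top_parity.
  rewrite (seq.permP permL) count_map -natr_bool -sum1_count natr_sum.
  rewrite big_enum_cond /= big_mkcondr /=.
  apply: eq_bigr => B _; rewrite odd_path_length //.
  by case: (top_parity sigma B).
- move/allP=> odd_B; apply/sqr_pow2/arf_sqr => B piB.
  by rewrite -odd_path_length //; apply: odd_B; rewrite mem_enum.
- case/allPn=> B; rewrite mem_enum => piB even_B; apply: (arf_eq0 piB).
  by rewrite -odd_path_length //; apply/negbTE.
Qed.
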